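(* The Automorphism Conjecture holds for ordered sets of width at most $11$; that is, $$\lim_{n\to\infty}\ \max\left\{ \frac{|\mathrm{Aut}(P)|}{|\mathrm{End}(P)|} : P \text{ a finite ordered set}, |P|=n, w(P)\leq 11\right\} = 0 .$$
   Context: For a finite ordered set $P$, $\mathrm{End}(P)$ is the set of order-preserving self-maps $f:P\to P$ (i.e. $p\leq q$ implies $f(p)\leq f(q)$) and $\mathrm{Aut}(P)$ is the set of automorphisms (order-preserving bijections whose inverse is order-preserving). The width $w(P)$ is the size of a largest antichain of $P$. *)

(* Defs.v *)
From HB Require Import structures.
From mathcomp Require Import all_boot all_order all_fingroup all_algebra.
From mathcomp Require Import all_classical all_reals all_analysis.

Set Implicit Arguments.
Unset Strict Implicit.
Unset Printing Implicit Defensive.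

Import Order.TTheory GRing.Theory Num.Theory.
Import numFieldNormedType.Exports.

Local Open Scope order_scope.

Definition order_preserving (d : Order.disp_t) (P : finPOrderType d)
    (f : P -> P) : bool :=
  [forall p, forall q, (p <= q) ==> (f p <= f q)].

Definition End (d : Order.disp_t) (P : finPOrderType d) : {set {ffun P -> P}} :=
  [set f : {ffun P -> P} | order_preserving f].

Definition Aut (d : Order.disp_t) (P : finPOrderType d) : {set {perm P}} :=
  [set s : {perm P} | order_preserving s && order_preserving (s^-1)%g].

Definition antichain (d : Order.disp_t) (P : finPOrderType d)
    (A : {set P}) : bool :=
  [forall p in A, forall q in A, (p != q) ==> (p >< q)].

Definition width (d : Order.disp_t) (P : finPOrderType d) : nat :=
  (\max_(A : {set P} | antichain A) #|A|)%N.

Local Close Scope order_scope.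
Local Open Scope classical_set_scope.
Local Open Scope ring_scope.

Definition aut_end_ratio (R : realType) (d : Order.disp_t)
    (P : finPOrderType d) : R :=
  #|Aut P|%:R / #|End P|%:R.

Definition aut_end_ratios (R : realType) (w n : nat) : set R :=
  [set x | exists (d : Order.disp_t) (P : finPOrderType d),
    [/\ #|P| = n, (width P <= w)%N & x = aut_end_ratio R P]].

Arguments aut_end_ratios : clear implicits.

Definition is_maximum (R : realType) (A : set R) (m : R) : Prop :=
  A m /\ ubound A m.

(* Main.v *)
(** Stratify [P] by height into levels [L_0, ..., L_m], antichains of size
    [l_i <= 11], and fix a chain [c_0 < ... < c_m] with [c_i] in [L_i].

    Sending each point of [L_i] to [c_i] or to [c_(i+1)] is order-preserving;
    composing such maps with automorphisms yields at least
    [|Aut P| / |G_C| * prod_(i < m) N_i] endomorphisms, where [N_i = 2 ^ l_i - 1]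
    ([N_i = 2] if [l_i = 1]) and [G_C] is the pointwise stabilizer of the chain.

    Call two points twins if they have the same strict lower and upper bounds.
    If there are [S] nontrivial twin classes, collapsing in each of them one
    point to another gives [2 ^ S * |Aut P| <= |End P|]. Otherwise at most [11 S]
    points have twins, and fixing them too costs [G_C] a factor depending on [S]
    only. In the resulting group [H] any two points of an orbit are separated by
    the comparability relation, and successively fixing points shows that
    [|H| ^ 2] is at most the number of permutations preserving the [H]-orbits,
    hence at most [prod_i (l_i - 1)!]. Since [8 (l - 1)! <= 7 N ^ 2] for
    [l <= 11], the ratio [|Aut P| / |End P|] decays like [(7 / 8) ^ (m / 2)]. *)

From mathcomp Require Import all_boot all_order all_fingroup.
From mathcomp Require Import zify ring.
Require Import Defs.

Set Implicit Arguments.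
Unset Strict Implicit.
Unset Printing Implicit Defensive.

Import Order.TTheory GroupScope.
Local Open Scope nat_scope.

(** * Permutations that preserve the orbits of a permutation group *)

(** This is the direct product of the symmetric groups on the orbits of [K]. *)
Definition orbit_perms (T : finType) (K : {set {perm T}}) : {set {perm T}} :=
  [set p : {perm T} | [forall x, p x \in orbit 'P K x]].

Lemma group_set_orbit_perms (T : finType) (K : {group {perm T}}) :
  group_set (orbit_perms K).
Proof.
apply/group_setP; split.
  by rewrite inE; apply/forallP => x; rewrite perm1 orbit_refl.
move=> p q; rewrite !inE => /forallP Hp /forallP Hq; apply/forallP => x.
by rewrite permM; exact: orbit_trans (Hq _) (Hp x).
Qed.

Canonical orbit_perms_group (T : finType) (K : {group {perm T}}) :=
  Group (group_set_orbit_perms K).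

Lemma sub_orbit_perms (T : finType) (K : {group {perm T}}) :
  K \subset orbit_perms K.
Proof.
apply/subsetP => g gK; rewrite inE; apply/forallP => x.
exact: (mem_orbit 'P x gK).
Qed.

(** Transpositions in [W] carry [F] to every set obtained by exchanging one point for another point
    of [E]. Exchanging [f] for a point outside [F], or another point of [F] for [g], gives [#|E|]
    distinct sets, counting [F] itself. *)
Lemma leq_card_orbit_set (T : finType) (W : {group {perm T}}) (E F : {set T})
    (f g : T) :
  F \subset E -> f \in F -> g \in E :\: F ->
  {in E &, forall x y, tperm x y \in W} ->
  #|E| <= #|orbit ('P^*) W F|.
Proof.
move=> /subsetP FE fF /setDP[gE gF] Wt.
pose phi e := if e == f then F else
  if e \in F then g |: (F :\ e) else e |: (F :\ f).
have Ft x y : x \in F -> y \notin F -> x \in E -> y \in E ->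
    y |: (F :\ x) \in orbit ('P^*) W F.
  move=> xF yF xE yE; apply/imsetP; exists (tperm x y); first exact: Wt.
  apply/setP => w; rewrite /= !inE.
  apply/idP/imsetP.
    case/orP => [/eqP->|/andP[wx wF]].
      by exists x; rewrite //= /aperm tpermL.
    exists w => //; rewrite /= /aperm tpermD // 1?eq_sym //.
    by apply: contraNneq yF => <-.
  case=> v vF ->; rewrite /= /aperm; case: tpermP => [_|vy|/eqP vx vy].
  - by rewrite eqxx.
  - by rewrite -vy vF in yF.
  - by rewrite vx vF orbT.
have phiO : phi @: E \subset orbit ('P^*) W F.
  apply/subsetP => _ /imsetP[e eE ->]; rewrite /phi.
  case: eqP => [_|_]; first exact: orbit_refl.
  by case: ifPn => eF; apply: Ft => //; apply: FE.
suff injphi : {in E &, injective phi}.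
  by rewrite -(card_in_imset injphi) subset_leq_card.
have nef e : e \notin F -> (e == f) = false.
  by move=> eF; apply: contraNF eF => /eqP->.
have out_in e1 e2 : e1 \notin F -> e2 \in F -> phi e1 = phi e2 -> False.
  move=> e1F e2F /setP/(_ f); rewrite /phi (nef _ e1F) (negPf e1F) e2F.
  rewrite !inE eqxx eq_sym (nef _ e1F) /=.
  by case: ifPn => [_|e2f]; rewrite ?inE fF // [f == e2]eq_sym e2f orbT.
have f_in e : e \in F -> e != f -> phi f = phi e -> False.
  move=> eF ef /setP/(_ g); rewrite /phi eqxx (negPf ef) eF.
  by rewrite !inE eqxx (negPf gF).
move=> e1 e2 _ _ h.
have [e1F|e1F] := boolP (e1 \in F); have [e2F|e2F] := boolP (e2 \in F).
- have [e1f|e1f] := eqVneq e1 f.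
    apply/eqP; apply/negPn/negP => ne; apply: (f_in e2) => //.
      by rewrite -e1f eq_sym.
    by rewrite -e1f.
  have [e2f|e2f] := eqVneq e2 f.
    by case: (f_in e1) => //; rewrite -e2f.
  move/setP/(_ e1): h; rewrite /phi (negPf e1f) (negPf e2f) e1F e2F !inE eqxx.
  rewrite e1F !andbT; case: (eqVneq e1 g) => [e1g|_].
    by rewrite -e1g e1F in gF.
  by move/esym/negbFE/eqP.
- by case: (out_in e2 e1).
- by case: (out_in e1 e2).
- move/setP/(_ e1): h; rewrite /phi !nef // (negPf e1F) (negPf e2F).
  by rewrite !inE eqxx (negPf e1F) andbF !orbF => /esym/eqP.
Qed.

(* Fixing one point [a] of the smaller of two orbits that are only partially
   related by [r] splits the larger orbit as well; a step that divides [#|K|]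
   by [#|orbit a|] therefore divides [#|orbit_perms K|] by at least its square. *)
Lemma leq_sqr_card_orbit_perms_step (T : finType) (r : rel T)
    (K : {group {perm T}}) (a b b' : T) :
  {in K, forall (g : {perm T}) x y, r (g x) (g y) = r x y} ->
  (forall x y, y \in orbit 'P K x -> ~~ r x y) ->
  b' \in orbit 'P K b -> r b a != r b' a ->
  #|orbit 'P K a| <= #|orbit 'P K b| ->
  #|'C_K[a | 'P]| ^ 2 <= #|orbit_perms 'C_K[a | 'P]| ->
  #|K| ^ 2 <= #|orbit_perms K|.
Proof.
move=> Kr Kind bb' rb leD IH.
set E := orbit 'P K b in leD bb'; set Ka := 'C_K[a | 'P]%G in IH.
pose F := [set w in E | r w a].
have bE : b \in E by exact: orbit_refl.
have [f fF [g gEF]] : exists2 f, f \in F & exists g, g \in E :\: F.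
  case rba : (r b a); [exists b; last exists b'|exists b'; last exists b];
    move: rb; rewrite !inE ?bE ?bb' rba //=; by case: (r b' a).
(* Otherwise no point of [E] would be related to [a], and [F] would be empty. *)
have aE : a \notin E.
  apply/negP => aE.
  have nr w : w \in E -> r w a = false.
    move=> wE; apply/negbTE/Kind; apply: orbit_trans aE _.
    by rewrite orbit_sym.
  by move: fF; rewrite inE => /andP[fE]; rewrite nr.
pose W := orbit_perms_group K; pose W1 := 'C_W[a | 'P]%G.
have cK : #|K| = (#|orbit 'P K a| * #|Ka|)%N by rewrite card_orbit_stab.
have cW : #|orbit_perms K| = (#|orbit 'P W a| * #|W1|)%N.
  by rewrite card_orbit_stab.
have cW1 : #|W1| = (#|orbit ('P^*) W1 F| * #|'C_W1[F | 'P^*]|)%N.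
  by rewrite card_orbit_stab.
have DW : #|orbit 'P K a| <= #|orbit 'P W a|.
  by apply/subset_leq_card/imsetS/sub_orbit_perms.
have EW : #|E| <= #|orbit ('P^*) W1 F|.
  apply: (@leq_card_orbit_set _ _ E F f g) => //.
    by apply/subsetP => w; rewrite inE => /andP[].
  move=> x y xE yE; rewrite inE; apply/andP; split.
    rewrite inE; apply/forallP => w; case: tpermP => [->|->|_ _].
    - by apply: orbit_trans yE _; rewrite orbit_sym.
    - by apply: orbit_trans xE _; rewrite orbit_sym.
    - exact: orbit_refl.
  apply/astab1P; rewrite /= /aperm tpermD //.
    by apply: contraNneq aE => <-.
  by apply: contraNneq aE => <-.
(* [Ka] fixes [a] and preserves [r], so none of its orbits leaves [F]. *)
have KW : orbit_perms Ka \subset 'C_W1[F | 'P^*].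
  apply/subsetP => p; rewrite inE => /forallP Kp.
  have pa : p a = a.
    by have /imsetP[k /setIP[_ /astab1P ka] ->] := Kp a.
  apply/setIP; split.
    apply/setIP; split; last exact/astab1P.
    rewrite inE; apply/forallP => x.
    by apply: subsetP (Kp x); apply/imsetS/subsetIl.
  apply/astab1P; apply/eqP; rewrite eqEcard /= card_imset ?leqnn ?andbT;
    last exact: perm_inj.
  apply/subsetP => _ /imsetP[w wF ->]; rewrite /= /aperm.
  have /imsetP[k /setIP[kK /astab1P ka] ->] := Kp w.
  move: wF; rewrite !inE => /andP[wE rwa]; apply/andP; split.
    by apply: orbit_trans _ wE; exact: (mem_orbit 'P w kK).
  by rewrite -[a in r _ a]ka /= /aperm Kr.
rewrite cW cW1 cK expnMn -mulnn -mulnA leq_mul //.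
rewrite leq_mul ?(leq_trans leD) //.
by apply: leq_trans IH (subset_leq_card KW).
Qed.

(** Induction on [#|K|]. If [g] moves [x], and [z] separates [x] from [g x], then [g] moves [z] too,
    and the orbits of [x] and [z] are only partially related, seen from either side. The one with
    the smaller orbit is fixed. *)
Lemma leq_sqr_card_orbit_perms (T : finType) (r : rel T)
    (K : {group {perm T}}) :
  symmetric r ->
  {in K, forall (g : {perm T}) x y, r (g x) (g y) = r x y} ->
  (forall x y, y \in orbit 'P K x -> ~~ r x y) ->
  (forall x y, y \in orbit 'P K x -> x != y -> exists z, r z x != r z y) ->
  #|K| ^ 2 <= #|orbit_perms K|.
Proof.
move=> rsym; have [n leKn] := ubnP #|K|; elim: n K leKn => // n IHn K leKn.
move=> Kr Kind Ksep.
have [K1|] := eqVneq (K : {set _}) 1%g.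
  by rewrite K1 cards1 -K1 cardG_gt0.
case/trivgPn => g gK g1.
have [x gx] : exists x, g x != x.
  apply/existsP; apply: contraNT g1 => /existsPn h.
  by apply/eqP/permP => x; rewrite perm1; apply/eqP/negPn/h.
have xg : g x \in orbit 'P K x by exact: (mem_orbit 'P x gK).
have [z rz] : exists z, r z x != r z (g x) by apply: Ksep; rewrite // eq_sym.
have zg : g^-1 z \in orbit 'P K z by exact: (mem_orbit 'P z (groupVr gK)).
have gz : g^-1 z != z.
  apply: contraNneq rz => {1}<-.
  by rewrite -(Kr g gK) permKV.
have IH a : (exists2 k, k \in K & k a != a) ->
    #|'C_K[a | 'P]| ^ 2 <= #|orbit_perms 'C_K[a | 'P]|.
  case=> k kK ka; have sub y : orbit 'P 'C_K[a | 'P] y \subset orbit 'P K y.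
    exact/imsetS/subsetIl.
  apply: IHn.
  - rewrite ltnS in leKn; apply: leq_trans leKn; apply: proper_card.
    rewrite properE subsetIl; apply: contra ka => /subsetP/(_ _ kK)/setIP[_].
    by move/astab1P => /= {2}<-.
  - by move=> h /setIP[hK _]; exact: Kr.
  - by move=> y y' /(subsetP (sub y)); exact: Kind.
  - by move=> y y' /(subsetP (sub y)); exact: Ksep.
case/orP: (leq_total #|orbit 'P K x| #|orbit 'P K z|) => le.
  apply: (@leq_sqr_card_orbit_perms_step _ r K x z (g^-1 z)) => //.
    by rewrite -(Kr g gK (g^-1 z)) permKV.
  by apply: IH; exists g.
apply: (@leq_sqr_card_orbit_perms_step _ r K z x (g x)) => //.
  by rewrite ![r _ z]rsym.
by apply: IH; exists g^-1; rewrite ?groupV.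
Qed.

(** Orbit-stabilizer, one point of [A] at a time; passing to a subgroup only shrinks orbits. *)
Lemma leq_card_pointwise_stab (T : finType) (K : {group {perm T}}) (k : nat)
    (A : {set T}) :
  (forall x, #|orbit 'P K x| <= k) -> #|K| <= k ^ #|A| * #|'C_K(A | 'P)|.
Proof.
move=> Kk; elim: {A}_.+1 {-2}A (ltnSn #|A|) => // n IH A ltA.
have [->|[a aA]] := set_0Vmem A.
  rewrite cards0 mul1n subset_leq_card //; apply/subsetP => p pK.
  by apply/setIP; split=> //; apply/astabP => x; rewrite inE.
have ltA' : #|A :\ a| < n by move: ltA; rewrite (cardsD1 a) aA.
apply: leq_trans (IH _ ltA') _; rewrite (cardsD1 a A) aA expnS -mulnA mulnCA.
rewrite leq_mul // -(card_orbit_stab 'P 'C_K(A :\ a | 'P)%G a) leq_mul //.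
  by apply: leq_trans (Kk a); apply/subset_leq_card/imsetS/subsetIl.
by rewrite /= -setIA -astabU setUC setD1K.
Qed.

(** * Automorphisms, endomorphisms and antichains *)

Lemma AutP (d : Order.disp_t) (P : finPOrderType d) (s : {perm P}) :
  reflect (forall x y, (s x <= s y)%O = (x <= y)%O) (s \in Aut P).
Proof.
rewrite inE; apply: (iffP andP) => [[Hs Hs'] x y|Hs].
  apply/idP/idP => xy.
    by have := forallP (forallP Hs' (s x)) (s y); rewrite xy !permK.
  by have := forallP (forallP Hs x) y; rewrite xy.
split; apply/forallP => x; apply/forallP => y; apply/implyP => xy.
  by rewrite Hs.
by rewrite -Hs !permKV.
Qed.

Lemma group_set_Aut (d : Order.disp_t) (P : finPOrderType d) :
  group_set (Aut P).
Proof.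
apply/group_setP; split=> [|s t /AutP Hs /AutP Ht]; apply/AutP => x y.
  by rewrite !perm1.
by rewrite !permM Ht Hs.
Qed.

Canonical Aut_group (d : Order.disp_t) (P : finPOrderType d) :=
  Group (group_set_Aut P).

Lemma Aut_lt (d : Order.disp_t) (P : finPOrderType d) (s : {perm P}) (x y : P) :
  s \in Aut P -> (s x < s y)%O = (x < y)%O.
Proof. by move=> /AutP Hs; rewrite !lt_def Hs (inj_eq perm_inj). Qed.

Lemma EndP (d : Order.disp_t) (P : finPOrderType d) (f : {ffun P -> P}) :
  (forall x y, (x < y)%O -> (f x <= f y)%O) -> f \in End P.
Proof.
move=> Hf; rewrite inE; apply/forallP => x; apply/forallP => y; apply/implyP.
by rewrite le_eqVlt => /predU1P[->|/Hf].
Qed.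

Lemma leq_card_width (d : Order.disp_t) (P : finPOrderType d) (A : {set P}) :
  {in A &, forall x y, ~~ (x < y)%O} -> #|A| <= width P.
Proof.
move=> HA; apply: leq_bigmax_cond.
apply/forall_inP => x xA; apply/forall_inP => y yA; apply/implyP => xy.
rewrite /Order.comparable !le_eqVlt (negPf xy) eq_sym (negPf xy).
by rewrite !(negPf (HA _ _ _ _)).
Qed.

(** * Heights, levels and chains that meet successive levels *)

(** Here [n] is fuel: every value above the number of strict lower bounds of [x] gives the same
    result, so [#|P|] suffices. *)
Fixpoint height_upto (d : Order.disp_t) (P : finPOrderType d) (n : nat)
    (x : P) : nat :=
  if n is n'.+1 then \max_(y : P | (y < x)%O) (height_upto n' y).+1 else 0.

Definition height (d : Order.disp_t) (P : finPOrderType d) (x : P) : nat :=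
  height_upto #|P| x.

Lemma height_upto_stable (d : Order.disp_t) (P : finPOrderType d) (n m : nat)
    (x : P) :
  #|[set y | (y < x)%O]| < n -> #|[set y | (y < x)%O]| < m ->
  height_upto n x = height_upto m x.
Proof.
elim: n m x => // n IHn [//|m] x ltn ltm /=; apply: eq_bigr => y yx.
have sub : [set z | (z < y)%O] \proper [set z | (z < x)%O].
  apply/properP; split; last by exists y; rewrite inE // ltxx.
  by apply/subsetP => z; rewrite !inE => /lt_trans->.
by congr _.+1; apply: IHn; apply: leq_trans (proper_card sub) _.
Qed.

Lemma heightE (d : Order.disp_t) (P : finPOrderType d) (x : P) :
  height x = \max_(y : P | (y < x)%O) (height y).+1.
Proof.
have ltP (y : P) : #|[set z | (z < y)%O]| < #|P|.
  rewrite -[X in _ < X]cardsT proper_card //; apply/properP; split.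
    exact: subsetT.
  by exists y; rewrite ?inE ?ltxx.
rewrite /height (@height_upto_stable _ _ _ #|P|.+1) ?ltP //.
by rewrite (leq_trans (ltP x)).
Qed.

Lemma ltn_height (d : Order.disp_t) (P : finPOrderType d) (x y : P) :
  (x < y)%O -> height x < height y.
Proof.
move=> xy; rewrite [height y]heightE.
by rewrite (leq_bigmax_cond (F := fun z => (height z).+1)).
Qed.

Lemma height_succ (d : Order.disp_t) (P : finPOrderType d) (x : P) (k : nat) :
  height x = k.+1 -> exists2 y, (y < x)%O & height y = k.
Proof.
move=> xk; have [/card0_eq x0|] := posnP #|[pred y : P | (y < x)%O]|.
  by move: xk; rewrite heightE big_pred0.
case/(eq_bigmax_cond (fun y => (height y).+1)) => y yx h; exists y => //.
by apply/eqP; rewrite -eqSS -xk [height x]heightE; apply/eqP/esym.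
Qed.

Lemma height_Aut (d : Order.disp_t) (P : finPOrderType d) (s : {perm P})
    (x : P) :
  s \in Aut P -> height (s x) = height x.
Proof.
rewrite /height => sA; elim: #|P| x => //= n IHn x.
rewrite (reindex_inj (@perm_inj _ s)); apply: eq_big => y; first exact: Aut_lt.
by rewrite IHn.
Qed.

(** A point of positive height has a lower bound exactly one level down; the chain descends from [x]
    in this way. *)
Lemma height_chain (d : Order.disp_t) (P : finPOrderType d) (x : P) :
  exists c : nat -> P,
    (forall i, i <= height x -> height (c i) = i) /\
    (forall i j, i <= j <= height x -> (c i <= c j)%O).
Proof.
suff [c [_ Hc]] : exists c : nat -> P, c (height x) = x /\
    ((forall i, i <= height x -> height (c i) = i) /\
    (forall i j, i <= j <= height x -> (c i <= c j)%O)) by exists c.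
move k: (height x) => k'; elim: k' x k => [|k IHk] x xk.
  exists (fun=> x); split=> //; split=> [i|//].
  by rewrite leqn0 => /eqP->.
have [y yx yk] := height_succ xk; have [c [cy [ch cle]]] := IHk y yk.
exists (fun i => if i <= k then c i else x); split; first by rewrite ltnn.
split=> [i|i j /andP[ij]].
  by rewrite leq_eqVlt ltnS => /predU1P[->|ik]; rewrite ?ltnn ?ik ?ch.
rewrite leq_eqVlt ltnS => /predU1P[jk|jk]; last first.
  by rewrite (leq_trans ij jk) jk; apply: cle; rewrite ij.
rewrite jk ltnn; case: leqP => [ik|//].
by apply: le_trans (ltW yx); rewrite -cy; apply: cle; rewrite ik leqnn.
Qed.

Definition level (d : Order.disp_t) (P : finPOrderType d) (i : nat) : {set P} :=
  [set x | height x == i].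
Arguments level {d} P i.

Lemma card_level (d : Order.disp_t) (P : finPOrderType d) (i : nat) :
  #|level P i| <= width P.
Proof.
apply: leq_card_width => x y; rewrite !inE => /eqP xi /eqP yi.
by apply/negP => /ltn_height; rewrite xi yi ltnn.
Qed.

(** * Twins and the endomorphisms that collapse them *)

(* Also for the strict order, twins have the same lower and the same upper
   bounds: see [twin_lt] and [twin_gt]. *)
Definition twin (d : Order.disp_t) (P : finPOrderType d) : rel P :=
  fun x y => [forall z, ((x < z) || (z < x) == (y < z) || (z < y))%O].

Lemma twinP (d : Order.disp_t) (P : finPOrderType d) (x y : P) :
  reflect (forall z, ((x < z) || (z < x) = (y < z) || (z < y))%O) (twin x y).
Proof. exact: 'forall_eqP. Qed.

Lemma twin_refl (d : Order.disp_t) (P : finPOrderType d) (x : P) : twin x x.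
Proof. exact/twinP. Qed.

Lemma twin_sym (d : Order.disp_t) (P : finPOrderType d) (x y : P) :
  twin x y = twin y x.
Proof. by apply/twinP/twinP => h z; rewrite h. Qed.

Lemma twin_trans (d : Order.disp_t) (P : finPOrderType d) (y x z : P) :
  twin x y -> twin y z -> twin x z.
Proof. by move=> /twinP xy /twinP yz; apply/twinP => t; rewrite xy yz. Qed.

Lemma twin_lt (d : Order.disp_t) (P : finPOrderType d) (x y z : P) :
  twin x y -> (x < z)%O = (y < z)%O.
Proof.
wlog suff: x y / twin x y -> (x < z)%O -> (y < z)%O.
  by move=> h xy; apply/idP/idP; apply: h; rewrite // twin_sym.
move=> /twinP xy xz; have := xy z; rewrite xz => /esym/orP[//|zy].
by have := xy y; rewrite (lt_trans xz zy) ltxx.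
Qed.

Lemma twin_gt (d : Order.disp_t) (P : finPOrderType d) (x y z : P) :
  twin x y -> (z < x)%O = (z < y)%O.
Proof.
wlog suff: x y / twin x y -> (z < x)%O -> (z < y)%O.
  by move=> h xy; apply/idP/idP; apply: h; rewrite // twin_sym.
move=> /twinP xy zx; have := xy z; rewrite zx orbT => /esym/orP[yz|//].
by have := xy y; rewrite (lt_trans yz zx) ltxx orbT.
Qed.

Lemma twin_Aut (d : Order.disp_t) (P : finPOrderType d) (s : {perm P})
    (x y : P) :
  s \in Aut P -> twin (s x) (s y) = twin x y.
Proof.
move=> sA; apply/twinP/twinP => h z.
  by have := h (s z); rewrite !Aut_lt.
by rewrite -(permKV s z) !Aut_lt.
Qed.

Lemma card_twin (d : Order.disp_t) (P : finPOrderType d) (x : P) :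
  #|[set y | twin x y]| <= width P.
Proof.
apply: leq_card_width => y z; rewrite !inE => xy xz.
by rewrite -(twin_lt z xy) (twin_lt z xz) ltxx.
Qed.

Definition with_twin (d : Order.disp_t) (P : finPOrderType d) : {set P} :=
  [set x | [exists y, (y != x) && twin x y]].
Arguments with_twin {d} P.

(** Take [X] maximal among sets of pairwise non-twins. The twin classes of its points cover
    [with_twin P], and each class is an antichain. *)
Lemma twin_representatives (d : Order.disp_t) (P : finPOrderType d) :
  exists X : {set P}, [/\ X \subset with_twin P,
    {in X &, forall x y, twin x y -> x = y} &
    #|with_twin P| <= width P * #|X|].
Proof.
pose Q (X : {set P}) := (X \subset with_twin P) &&
  [forall x in X, forall y in X, twin x y ==> (x == y)].
have QP (X : {set P}) : reflect (X \subset with_twin P /\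
    {in X &, forall x y, twin x y -> x = y}) (Q X).
  apply: (iffP andP) => -[XT h]; split=> //.
    move=> x y xX yX xy; apply/eqP.
    by move/forall_inP/(_ x xX)/forall_inP/(_ y yX)/implyP/(_ xy): h.
  apply/forall_inP => x xX; apply/forall_inP => y yX; apply/implyP => xy.
  by apply/eqP/h.
have [|X /maxsetP[/QP[XT Xtw] Xmax]] := @ex_maxset _ Q.
  by exists set0; apply/QP; split=> [|x y]; rewrite ?sub0set ?inE.
exists X; split=> //.
have cov : with_twin P \subset \bigcup_(x in X) [set y | twin x y].
  apply/subsetP => y yT; apply/bigcupP/exists_inP; apply: contraT.
  move=> /exists_inPn h.
  have yX : y \notin X.
    by apply/negP => /h; rewrite inE twin_refl.
  case/negP: yX; rewrite -(Xmax (y |: X)) ?setU11 ?subsetUr //.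
  apply/QP; split; first by rewrite subUset sub1set yT.
  move=> x z /setU1P[->|xX] /setU1P[->|zX] //; last exact: Xtw.
    by have := h z zX; rewrite inE twin_sym => /negPf->.
  by have := h x xX; rewrite inE => /negPf->.
apply: leq_trans (subset_leq_card cov) _.
apply: leq_trans (_ : \sum_(x in X) #|[set y | twin x y]| <= _).
  elim/big_rec2: _ => [|x n A _ le]; first by rewrite cards0.
  by rewrite (leq_trans (leq_card_setU _ _)) // leq_add2l.
by rewrite mulnC -sum_nat_const; apply: leq_sum => x _; exact: card_twin.
Qed.

(* For [A] a set of points, pairwise not twins, that have twins, collapse each
   point of [A] to one of its twins and follow with an automorphism [g]. The
   composite determines [A], and then [g] up to the images of the points of
   [A], which are the only points missed inside their twin classes. *)
Lemma leq_card_End_twin (d : Order.disp_t) (P : finPOrderType d) (X : {set P}) :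
  X \subset with_twin P -> {in X &, forall x y, twin x y -> x = y} ->
  2 ^ #|X| * #|Aut P| <= #|End P|.
Proof.
move=> /subsetP XT Xtw.
pose b (x : P) := odflt x [pick y | (y != x) && twin x y].
have bP x : x \in X -> b x != x /\ twin x (b x).
  move/XT; rewrite inE /b => /existsP[y yx].
  by case: pickP => [z /andP[]|/(_ y)] //; rewrite yx.
have bX x : x \in X -> b x \notin X.
  move=> xX; have [bx tx] := bP x xX; apply: contra bx => bX.
  by rewrite eq_sym; apply/eqP/Xtw.
pose u (A : {set P}) (x : P) := if x \in A then b x else x.
have tu (A : {set P}) x : A \subset X -> twin x (u A x).
  move=> /subsetP AX; rewrite /u; case: ifP => [xA|_]; last exact: twin_refl.
  by case: (bP x (AX x xA)).
pose F (p : {set P} * {perm P}) := [ffun x : P => p.2 (u p.1 x)].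
have FE : F @: setX (powerset X) (Aut P) \subset End P.
  apply/subsetP => _ /imsetP[[A g] /setXP[/= AX gA] ->].
  rewrite powersetE in AX; apply: EndP => x y xy; rewrite !ffunE ltW //=.
  by rewrite Aut_lt // -(twin_lt _ (tu A x AX)) -(twin_gt _ (tu A y AX)).
suff injF : {in setX (powerset X) (Aut P) &, injective F}.
  by rewrite -card_powerset -cardsX -(card_in_imset injF) subset_leq_card.
move=> [A g] [B h] /setXP[/= AX gA] /setXP[/= BX hA] FAB.
rewrite !powersetE in AX BX.
have Fx x : g (u A x) = h (u B x).
  by have /ffunP/(_ x) := FAB; rewrite !ffunE.
have ub (C : {set P}) x : C \subset X -> x \in X -> u C (b x) = b x.
  move=> CX xX; rewrite /u ifN //; apply: contra (bX x xX).
  exact: (subsetP CX).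
have uA (C : {set P}) x : C \subset X -> x \in X -> (x \in C) = (u C x == b x).
  move=> CX xX; rewrite /u; case: ifP => _; rewrite ?eqxx //.
  by rewrite eq_sym (negPf (proj1 (bP x xX))).
(* For [x] in [X] the point [b x] is outside [X], hence never collapsed. So [x] was collapsed
   exactly when the composite agrees at [x] and [b x]. *)
have AB : A = B.
  apply/setP => x; have [xX|xX] := boolP (x \in X); last first.
    by apply/idP/idP => xC; case/negP: xX; apply: subsetP xC.
  have gb : g (b x) = h (b x) by have := Fx (b x); rewrite !ub.
  rewrite (uA A) // (uA B) // -[LHS](inj_eq (@perm_inj _ g)).
  by rewrite -[RHS](inj_eq (@perm_inj _ h)) Fx gb.
congr (_, _) => //; subst B; apply/permP => x.
have gh y : y \notin A -> g y = h y.
  by move=> yA; have := Fx y; rewrite /u (negPf yA).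
have [xA|/gh//] := boolP (x \in A).
have xX : x \in X by apply: (subsetP AX).
have [bx tx] := bP x xX.
have bA : b x \notin A by apply: contra (bX x xX); exact: (subsetP AX).
(* Since [g] and [h] agree at [b x], the point [y] is a twin of [x]. Inside [A] it must be [x];
   outside [A], where [g] and [h] agree, injectivity of [g] gives a contradiction. *)
pose y := h^-1%g (g x).
have hy : h y = g x by rewrite permKV.
have yx : twin y x.
  apply: (@twin_trans _ _ (b x)); last by rewrite twin_sym.
  by rewrite -(twin_Aut _ _ hA) hy -(gh _ bA) twin_Aut.
have [yA|yA] := boolP (y \in A).
  by rewrite -hy (Xtw y x) // (subsetP AX).
by move: hy; rewrite -gh // => /perm_inj yx'; rewrite yx' xA in yA.
Qed.

(** * Endomorphisms whose image is a chain *)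

Lemma leq_card_fibers (U V : finType) (F : U -> V) (X : {set U}) (Y : {set V})
    (k : nat) :
  {in X, forall x, F x \in Y} ->
  {in X, forall x, #|[set x' in X | F x' == F x]| <= k} ->
  #|X| <= #|Y| * k.
Proof.
move=> XY Xk; rewrite -sum1_card (partition_big F (mem Y)) //=.
rewrite -sum_nat_const; apply: leq_sum => y yY.
rewrite -[X in X <= _](_ : #|[set x in X | F x == y]| = _); last first.
  by rewrite -sum1_card; apply: eq_bigl => x; rewrite inE.
have [->|[x]] := set_0Vmem [set x in X | F x == y]; first by rewrite cards0.
by rewrite inE => /andP[xX /eqP <-]; apply: Xk.
Qed.

Lemma card_ffun_family (I T : finType) (F : I -> {set T}) :
  #|[set B : {ffun I -> T} | B \in family F]| = \prod_i #|F i|.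
Proof. by rewrite cardsE card_family foldrE big_map big_enum. Qed.

(* The number of ways to send each point of a level of size [l] to [c_i] or to
   [c_(i+1)], hitting [c_i] unless [l] is 1, when [c_i] is rigid anyway. *)
Definition level_maps (l : nat) : nat := if l == 1 then 2 else 2 ^ l - 1.

(** Points in [B i] are raised from [c i] to [c i.+1], then [g] is applied. A raise by one is
    absorbed by the strict growth of height, so order is preserved. Heights of images recover [B],
    and the images determine [g] on the chain, so each fiber lies in one coset of the stabilizer. *)
Lemma leq_card_End_chain (d : Order.disp_t) (P : finPOrderType d) (m : nat)
    (c : nat -> P) :
  (forall x : P, height x <= m) -> (forall i, i <= m -> height (c i) = i) ->
  (forall i j, i <= j <= m -> (c i <= c j)%O) ->
  #|Aut P| * \prod_(i < m) level_maps #|level P i| <=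
  #|End P| * #|'C_(Aut P)([set c (val i) | i : 'I_m.+1] | 'P)|.
Proof.
move=> hm ch cle.
(* Excluding the full level leaves some point at [c i], where the value of [g] can be read off. *)
pose S (i : 'I_m) := if #|level P i| == 1 then powerset (level P i)
  else powerset (level P i) :\ level P i.
have SP i (A : {set P}) : A \in S i -> A \subset level P i /\
    (#|level P i| != 1 -> ~~ (level P i \subset A)).
  rewrite /S; case: eqP => _; first by rewrite powersetE.
  rewrite !inE eqEsubset => /andP[nA sA]; split=> // _.
  by move: nA; rewrite sA.
have cS i : #|S i| = level_maps #|level P i|.
  rewrite /S /level_maps; case: eqP => [l1|_]; first by rewrite card_powerset l1.
  rewrite -card_powerset (cardsD1 (level P i) (powerset _)).
  by rewrite powersetE subxx addKn.
rewrite -(eq_bigr _ (fun i _ => cS i)) -card_ffun_family -cardsX.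
pose up (B : {ffun 'I_m -> {set P}}) (x : P) := [exists i, x \in B i].
have upE B (i : 'I_m) x : B \in family S ->
    (x \in B i) = (height x == i) && up B x.
  move=> /familyP HB; have sub j := subsetP (proj1 (SP j _ (HB j))).
  apply/idP/andP => [xB|[xi /existsP[j xB]]].
    by split; [have := sub i x xB; rewrite inE|apply/existsP; exists i].
  have := sub j x xB; rewrite inE (eqP xi) => /eqP ij.
  by rewrite (_ : i = j) //; apply: val_inj.
have up_lt B x : B \in family S -> height x + up B x <= m.
  move=> HB; case: (boolP (up B x)) => [/existsP[i]|_]; last by rewrite addn0.
  by rewrite upE // addn1 => /andP[/eqP-> _].
pose F (p : {perm P} * {ffun 'I_m -> {set P}}) :=
  [ffun x : P => p.1 (c (height x + up p.2 x))].
apply: (leq_card_fibers (F := F)) => [[g B] /setXP[/= gA]|[g0 B0] /setXP[/= g0A]].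
  rewrite inE => HB; apply: EndP => x y xy; rewrite !ffunE /=.
  move/AutP: gA => ->; apply: cle; rewrite up_lt // andbT.
  apply: leq_trans (leq_addr _ _); apply: leq_trans (ltn_height xy).
  by rewrite -addn1 leq_add2l leq_b1.
rewrite inE => HB0.
set GC := 'C_(Aut P)(_ | 'P).
apply: leq_trans (leq_imset_card (fun k => (k * g0, B0)%g) GC).
apply: subset_leq_card; apply/subsetP => -[g B].
rewrite inE => /andP[/setXP[/= gA]]; rewrite inE => HB /eqP FE.
have Fx x : g (c (height x + up B x)) = g0 (c (height x + up B0 x)).
  by have /ffunP/(_ x) := FE; rewrite !ffunE.
have upB x : up B x = up B0 x.
  have := congr1 (@height _ P) (Fx x); rewrite !height_Aut // !ch ?up_lt //.
  by move/addnI; case: (up B x); case: (up B0 x).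
have BB0 : B = B0.
  by apply/ffunP => i; apply/setP => x; rewrite !upE // upB.
apply/imsetP; exists (g * g0^-1)%g; last by rewrite mulgKV BB0.
apply/setIP; split; first by rewrite groupM ?groupV.
apply/astabP => _ /imsetP[i _ ->]; rewrite /= /aperm permM.
suff -> : g (c i) = g0 (c i) by rewrite permK.
have im : i <= m by rewrite -ltnS.
(* A point sent to [g (c i)]: [c m] on top, which is never raised, or an unraised point below. A
   singleton level needs none, being fixed by all automorphisms. *)
have [x xi] : exists x, height x + up B x = i \/ #|level P i| == 1 /\ i < m.
  have := im; rewrite leq_eqVlt => /predU1P[->|lim].
    exists (c m); left; have := up_lt B (c m) HB.
    by rewrite ch //; case: (up B (c m)); rewrite ?addn0 // addn1 ltnn.
  have [l1|l1] := eqVneq #|level P i| 1; first by exists (c i); right.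
  have /familyP/(_ (Ordinal lim))/SP[_ /(_ l1)/subsetPn[x xl xB]] := HB.
  exists x; left; move: xl; rewrite inE => /eqP xi.
  by move: xB; rewrite upE // xi eqxx /= => /negPf->; rewrite addn0.
case: xi => [xi|[/cards1P[z lz] _]].
  by have := Fx x; rewrite -upB xi.
have inl (h : {perm P}) : h \in Aut P -> h (c i) = z.
  by move=> hA; apply/set1P; rewrite -lz inE height_Aut // ch.
by rewrite !inl.
Qed.

(** * Factorial bounds for the stabilizer of the chain *)

(** Restriction to the levels, each without its chain point, embeds [W] into a product of symmetric
    groups. *)
Lemma leq_card_level_perms (d : Order.disp_t) (P : finPOrderType d) (m : nat)
    (c : nat -> P) (W : {set {perm P}}) :
  (forall x : P, height x <= m) -> (forall i, i <= m -> height (c i) = i) ->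
  {in W, forall (p : {perm P}) x, height (p x) = height x} ->
  {in W, forall (p : {perm P}) i, i <= m -> p (c i) = c i} ->
  #|W| <= \prod_(i < m.+1) (#|level P i|.-1)`!.
Proof.
move=> hm ch Wh Wc.
pose D (i : 'I_m.+1) := level P i :\ c i.
have cD (i : 'I_m.+1) : (#|level P i|.-1)`! = #|[set s | perm_on (D i) s]|.
  have -> : #|[set s | perm_on (D i) s]| = #|D i|`!.
    by rewrite -card_perm; apply: eq_card => s; rewrite inE.
  by rewrite (cardsD1 (c i) (level P i)) inE ch ?eqxx // -ltnS.
rewrite (eq_bigr _ (fun i _ => cD i)) -card_ffun_family.
have WN (i : 'I_m.+1) (p : {perm P}) : p \in W -> p \in 'N(D i | 'P).
  move=> pW; apply/astabsP => x; rewrite /= /aperm !inE Wh //; congr (~~ _ && _).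
  by rewrite -[in LHS](Wc p pW i) ?(inj_eq perm_inj) // -ltnS.
pose F (p : {perm P}) := [ffun i : 'I_m.+1 => restr_perm (D i) p].
have FW : F @: W \subset [set B | B \in family (fun i => [set s | perm_on (D i) s])].
  apply/subsetP => _ /imsetP[p _ ->]; rewrite inE; apply/familyP => i.
  by rewrite ffunE inE restr_perm_on.
rewrite -(card_in_imset (_ : {in W &, injective F})) ?subset_leq_card //.
move=> p q pW qW Fpq; apply/permP => x.
have hx : height x < m.+1 by rewrite ltnS.
have [->|xc] := eqVneq x (c (height x)); first by rewrite !Wc.
have xD : x \in D (Ordinal hx) by rewrite !inE xc /=.
have /ffunP/(_ (Ordinal hx)) := Fpq; rewrite !ffunE => /permP/(_ x).
by rewrite !restr_permE ?WN.
Qed.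

(* This inequality fails at [l = 12] even with both constants dropped. *)
Lemma leq_fact_level_maps (l : nat) :
  0 < l <= 11 -> 8 * (l.-1)`! <= 7 * level_maps l ^ 2.
Proof.
case/andP; case: l => // l _.
do 11?[case: l => [_|l]; first by rewrite /level_maps ?factS fact0 /=; lia].
by [].
Qed.

(** Orbits of [H] stay within levels, hence are antichains. Two distinct points of an orbit that
    comparability does not separate would be twins, but [H] fixes every point that has a twin. *)
Lemma leq_sqr_card_twinfree_stab (d : Order.disp_t) (P : finPOrderType d)
    (m : nat) (c : nat -> P) (H : {group {perm P}}) :
  (forall x : P, height x <= m) -> (forall i, i <= m -> height (c i) = i) ->
  H \subset 'C_(Aut P)([set c (val i) | i : 'I_m.+1] | 'P) ->
  H \subset 'C(with_twin P | 'P) ->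
  #|H| ^ 2 <= \prod_(i < m.+1) (#|level P i|.-1)`!.
Proof.
move=> hm ch; rewrite subsetI => /andP[/subsetP HA /subsetP HC] /subsetP HT.
have Oh x y : y \in orbit 'P H x -> height y = height x.
  by case/imsetP => g gH ->; rewrite height_Aut // HA.
pose r : rel P := fun x y => ((y < x) || (x < y))%O.
apply: (@leq_trans #|orbit_perms H|); last first.
  apply: (leq_card_level_perms hm ch) => [p + x|p + i im];
    rewrite inE => /forallP pW; first exact/Oh/pW.
  have /imsetP[g gH ->] := pW (c i).
  by apply: (astabP (HC g gH)); apply/imsetP; exists (Ordinal (im : i < m.+1)).
apply: (@leq_sqr_card_orbit_perms _ r) => [x y|g gH x y|x y yx|x y yx xy].
- by rewrite /r orbC.
- by rewrite /r !Aut_lt // HA.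
- rewrite /r; apply/norP.
  by split; apply/negP => /ltn_height; rewrite (Oh x y yx) ltnn.
apply/existsP; apply: contraT => /existsPn txy.
have tx : twin x y by apply/twinP => z; apply/eqP/negbNE/txy.
have xT : x \in with_twin P.
  by rewrite inE; apply/existsP; exists y; rewrite eq_sym xy.
case/imsetP: yx => g gH yx; case/eqP: xy; rewrite yx.
by rewrite (astabP (HT g gH)).
Qed.

(** * Exponential decay of the ratio *)

(** Here [m] is the largest height. Everything is squared because the stabilizer is bounded only
    through its square. *)
Lemma card_Aut_End_bound (d : Order.disp_t) (P : finPOrderType d) (x0 : P) :
  width P <= 11 -> exists m,
    #|P| <= 11 * m.+1 /\
    #|Aut P| ^ 2 * 8 ^ m <=
      #|End P| ^ 2 * (11 ^ (2 * #|with_twin P|) * 10`! * 7 ^ m).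
Proof.
move=> w11; case: (@bigop.eq_bigmax _ (@height _ P)) => [|x xm].
  by apply/card_gt0P; exists x0.
pose m := height x.
have hm (y : P) : height y <= m by rewrite /m -xm leq_bigmax.
have [c [ch cle]] := height_chain x.
pose l i := #|level P i|.
have l11 i : l i <= 11 by apply: leq_trans (card_level P i) w11.
have l0 i : i <= m -> 0 < l i.
  by move=> im; apply/card_gt0P; exists (c i); rewrite inE ch.
exists m; split.
  rewrite -cardsT; apply: (@leq_trans (\sum_(i < m.+1) #|level P i|)).
    pose lev (y : P) : 'I_m.+1 := inord (height y).
    rewrite -sum1_card (partition_big lev xpredT) //=.
    apply: leq_sum => i _; rewrite sum1_card; apply/subset_leq_card/subsetP => y.
    by rewrite !inE => /andP[_ /eqP <-]; rewrite inordK // ltnS.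
  apply: (@leq_trans (\sum_(i < m.+1) 11)).
    by apply: leq_sum => i _; exact: l11.
  by rewrite sum_nat_const card_ord mulnC.
pose GC := [group of 'C_(Aut P)([set c (val i) | i : 'I_m.+1] | 'P)].
pose H := [group of 'C_GC(with_twin P | 'P)].
have GCH : #|GC| <= 11 ^ #|with_twin P| * #|H|.
  apply: leq_card_pointwise_stab => y; apply: leq_trans (l11 (height y)).
  apply/subset_leq_card/subsetP => _ /imsetP[g gGC ->].
  by rewrite inE height_Aut //; case/setIP: gGC.
have HW : #|H| ^ 2 <= \prod_(i < m.+1) (l i).-1`!.
  by apply: (leq_sqr_card_twinfree_stab hm ch); rewrite ?subsetIl ?subsetIr.
have AE := leq_card_End_chain hm ch cle; rewrite -/GC in AE.
pose N := \prod_(i < m) level_maps (l i).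
have N0 : 0 < N ^ 2.
  rewrite expn_gt0 prodn_gt0 // => i; rewrite /level_maps; case: eqP => // _.
  have : 0 < l i by apply: l0; exact: ltnW.
  by case: (l i) => // k _; rewrite subn_gt0 -{1}(expn0 2) ltn_exp2l.
have LN : 8 ^ m * \prod_(i < m) (l i).-1`! <= 7 ^ m * N ^ 2.
  have cst k : k ^ m = \prod_(i < m) k by rewrite prod_nat_const card_ord.
  rewrite !cst -mulnn -!big_split /=; apply: leq_prod => i _.
  by rewrite mulnn leq_fact_level_maps // l0 ?l11 // ltnW.
(* The top level has no factor in [N], so its factorial goes into the constant. *)
have lm10 : (l m).-1`! <= 10`!.
  by apply: leq_fact; rewrite -ltnS prednK ?l11 ?l0.
rewrite big_ord_recr /= in HW; rewrite -(leq_pmul2r N0).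
rewrite [2 * #|_|]mulnC expnM -!mulnn in LN HW *.
move: AE GCH HW LN lm10; rewrite -/N.
move: #|Aut P| #|End P| #|GC| #|H| (N) (11 ^ _) (8 ^ m) (7 ^ m)
  (l m).-1`! 10`! (\prod_(i < m) _) => A E G h n t e8 e7 q f p AE Gh hp pn qf.
clear -AE Gh hp pn qf.
have {AE Gh} AE : A * n <= E * t * h.
  by rewrite -mulnA; apply: leq_trans AE (leq_mul _ _).
have {}hp : h * h <= p * f by apply: leq_trans hp (leq_mul _ _).
apply: (@leq_trans (E * t * (E * t) * f * (e8 * p))); last first.
  apply: leq_trans (leq_mul (leqnn _) pn) _; apply: eq_leq; ring.
have -> : A * A * e8 * (n * n) = A * n * (A * n) * e8 by ring.
have -> : E * t * (E * t) * f * (e8 * p) = E * t * (E * t) * (p * f) * e8 by ring.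
rewrite leq_mul // (leq_trans (leq_mul AE AE)) //.
have -> : E * t * h * (E * t * h) = E * t * (E * t) * (h * h) by ring.
by rewrite leq_mul.
Qed.

(** Bernoulli's inequality for [(1 + 1/7) ^ m], with denominators cleared. *)
Lemma bernoulli_eighth (m : nat) : (7 + m) * 7 ^ m <= 7 * 8 ^ m.
Proof. by elim: m => // m IH; rewrite !expnS; nia. Qed.

Lemma Aut_End_exponential (S : nat) : exists N, forall (d : Order.disp_t)
    (P : finPOrderType d),
  N <= #|P| -> width P <= 11 -> 2 ^ S * #|Aut P| <= #|End P|.
Proof.
(* If fewer than [S] representatives exist, at most [11 * S] points have twins, and [K] collects all
   factors independent of [m]. The threshold on [#|P|] forces [7 * K <= m], which makes [(8/7) ^ m]
   exceed [K]. *)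
pose K := (2 ^ S) ^ 2 * (11 ^ (2 * (11 * S)) * 10`!).
exists (11 * (7 * K).+1).+1 => d P leP w11.
have [x0 _] : exists x, x \in P by apply/card_gt0P; apply: leq_trans leP.
have [X [XT Xtw TX]] := twin_representatives P.
have [SX|XS] := leqP S #|X|.
  by apply: leq_trans (leq_card_End_twin XT Xtw); rewrite leq_mul // leq_exp2l.
have TS : #|with_twin P| <= 11 * S.
  by apply: leq_trans TX (leq_mul w11 (ltnW XS)).
have [m [Pm AE]] := card_Aut_End_bound x0 w11.
have Km : 7 * K <= m.
  by have := leq_trans leP Pm; rewrite ltn_pmul2l // ltnS => /ltnW.
have K8 : K * 7 ^ m <= 8 ^ m.
  rewrite -(@leq_pmul2l 7) // mulnA; apply: leq_trans (bernoulli_eighth m).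
  by rewrite leq_mul // (leq_trans Km) // leq_addl.
move: K8; rewrite /K; clear -AE TS; move: 10`! AE => f AE K8.
rewrite -(leq_exp2r _ _ (isT : 0 < 2)) expnMn.
rewrite -(@leq_pmul2r (8 ^ m)) ?expn_gt0 // -[X in X <= _]mulnA.
apply: leq_trans (leq_mul (leqnn _) AE) _; rewrite [X in X <= _]mulnCA leq_mul //.
apply: leq_trans K8; rewrite [X in X <= _]mulnA leq_mul // leq_mul // leq_mul //.
by rewrite leq_pexp2l // leq_mul.
Qed.

(** * Existence of the maxima, and the limit *)

(** Chains show that the set of ratios is nonempty at every size. *)
Lemma width_ord (n : nat) : width 'I_n <= 1.
Proof.
apply/bigmax_leqP => A /forall_inP HA.
apply/card_le1_eqP => x y xA yA; apply/eqP; apply: contraT => xy.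
have /forall_inP/(_ x xA)/implyP/(_ xy) := HA y yA.
by rewrite /Order.comparable le_total.
Qed.

Lemma leq_card_Aut (d : Order.disp_t) (P : finPOrderType d) :
  #|Aut P| <= #|P|`!.
Proof.
rewrite -cardsT -card_perm; apply/subset_leq_card/subsetP => s _.
by rewrite unfold_in; apply/subsetP => x; rewrite inE.
Qed.

Lemma leq_card_End (d : Order.disp_t) (P : finPOrderType d) :
  #|End P| <= #|P| ^ #|P|.
Proof. by rewrite -card_ffun max_card. Qed.

Lemma card_End_gt0 (d : Order.disp_t) (P : finPOrderType d) : 0 < #|End P|.
Proof.
by apply/card_gt0P; exists [ffun x => x]; apply: EndP => x y /ltW; rewrite !ffunE.
Qed.

From mathcomp Require Import all_algebra.
From mathcomp Require Import all_classical all_reals all_analysis.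
Import Order.TTheory GRing.Theory Num.Theory.
Import numFieldNormedType.Exports.
Local Open Scope classical_set_scope.
Local Open Scope ring_scope.

(* The posets range over a large type, but the pairs of cardinals
   [(#|Aut P|, #|End P|)] that occur at size [n] over a finite one. *)
Lemma aut_end_ratios_maximum (R : realType) (n : nat) :
  exists m : R, is_maximum (aut_end_ratios R 11 n) m.
Proof.
pose T := ('I_(n`!).+1 * 'I_(n ^ n).+1)%type.
pose Q (p : T) := `[< exists (d : Order.disp_t) (P : finPOrderType d),
  [/\ #|P| = n, (width P <= 11)%N, #|Aut P| = p.1 & #|End P| = p.2] >].
pose F (p : T) : R := (p.1 : nat)%:R / (p.2 : nat)%:R.
have QP d (P : finPOrderType d) : #|P| = n -> (width P <= 11)%N ->
    exists2 p, Q p & F p = aut_end_ratio R P.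
  move=> Pn Pw.
  have la : (#|Aut P| < (n`!).+1)%N by rewrite ltnS -Pn leq_card_Aut.
  have le : (#|End P| < (n ^ n).+1)%N by rewrite ltnS -Pn leq_card_End.
  by exists (Ordinal la, Ordinal le) => //; apply/asboolP; exists d, P.
have In : (width 'I_n <= 11)%N by apply: leq_trans (width_ord n) _.
have [p0 Qp0 _] := QP _ 'I_n (card_ord n) In.
case: (@Order.TotalTheory.arg_maxP _ _ _ p0 Q F Qp0) => p.
move=> /asboolP[d [P [Pn Pw PA PE]]] pmax.
exists (F p); split.
  by exists d, P; split=> //; rewrite /F -PA -PE.
move=> _ [d' [P' [Pn' Pw' ->]]].
by have [p' Qp' <-] := QP _ P' Pn' Pw'; exact: pmax.
Qed.

Theorem theorem7p11 (R : realType) :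
  exists M : nat -> R,
    (forall n : nat, is_maximum (aut_end_ratios R 11 n) (M n)) /\
    (M @ \oo --> (0 : R)).
Proof.
have /choice[M HM] := aut_end_ratios_maximum R.
exists M; split=> //; apply/cvgrPdist_le => e e0.
(* Then [2 ^ S > S > 1 / e], so a ratio of at most [1 / 2 ^ S] is below [e]. *)
pose S := Num.bound e^-1.
have [N HN] := Aut_End_exponential S.
exists N => // n /= Nn; have [[d [P [Pn Pw ->]]] _] := HM n.
have E0 : (0 : R) < #|End P|%:R by rewrite ltr0n card_End_gt0.
rewrite sub0r normrN ger0_norm ?divr_ge0 // /aut_end_ratio ler_pdivrMr //.
have eS : 1 <= e * (2 ^ S)%:R :> R.
  rewrite mulrC -ler_pdivrMr // div1r ltW //.
  apply: lt_trans (archi_boundP _) _; first by rewrite invr_ge0 ltW.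
  by rewrite ltr_nat ltn_expl.
apply: (@le_trans _ _ (e * (2 ^ S)%:R * #|Aut P|%:R)).
  by rewrite ler_peMl.
rewrite -mulrA ler_pM2l // -natrM ler_nat; apply: HN => //.
by rewrite Pn.
Qed.
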